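(* Let $X$ be a $d^{*}$-space and let $Y$ be a topological space that is a retract of $X$. Then $Y$ is a $d^{*}$-space.
   Context: A topological space $Y$ is a retract of a topological space $X$ if there are continuous maps $s:Y\to X$ and $r:X\to Y$ with $r\circ s=\mathrm{id}_Y$. For a $T_0$ space $X$, the specialization order is $x\leq y$ iff $x\in\overline{\{y\}}$, and ${\uparrow}x=\{y\in X\mid x\leq y\}$. A subset of a poset is directed if it is nonempty and each of its finite subsets has an upper bound in it. A $T_0$ space $X$ is a $d^{*}$-space if for every directed subset $D$ of $X$ (in the specialization order), every $x\in X$ and every nonempty open set $U\subseteq X$, $\bigcap_{d\in D}{\uparrow}d\cap{\uparrow}x\subseteq U$ implies ${\uparrow}d\cap{\uparrow}x\subseteq U$ for some $d\in D$. *)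

(* Defs.v *)
From mathcomp Require Import all_boot all_classical topology.
Set Implicit Arguments.
Unset Strict Implicit.
Unset Printing Implicit Defensive.
Local Open Scope classical_set_scope.

Definition is_retract (Y X : topologicalType) : Prop :=
  exists (s : Y -> X) (r : X -> Y),
    [/\ continuous s, continuous r & r \o s = id].

Definition spec_le (X : topologicalType) (x y : X) : Prop :=
  closure [set y] x.

Definition upset (X : topologicalType) (x : X) : set X :=
  [set y | spec_le x y].

Definition directed (X : topologicalType) (D : set X) : Prop :=
  D !=set0 /\
  forall F : set X, finite_set F -> F `<=` D ->
    exists2 u, D u & forall x, F x -> spec_le x u.

Definition dstar_space (X : topologicalType) : Prop :=
  kolmogorov_space X /\
  forall (D : set X) (x : X) (U : set X),
    directed D -> open U -> U !=set0 ->
    (\bigcap_(d in D) upset d) `&` upset x `<=` U ->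
    exists2 d, D d & upset d `&` upset x `<=` U.

(* Main.v *)
Require Import Defs.
From mathcomp Require Import all_boot all_classical topology.

Local Open Scope classical_set_scope.

(** Continuous maps are monotone for the specialization order, so the d*-condition for [D], [y], [U]
    in [Y] is transported to [X]: [s] carries [D] and [y] forward, and [U] is replaced by its
    preimage under [r]. The element [s d] found in [X] yields [d], because [r] undoes [s]. The T0
    axiom passes to [Y] since [s] is injective and continuous. *)

Lemma spec_le_continuous (X Y : topologicalType) (f : X -> Y) (x y : X) :
  continuous f -> spec_le x y -> spec_le (f x) (f y).
Proof.
move=> cf xy B fxB.
have [_ [-> By]] := xy _ (cf x B fxB).
by exists (f y).
Qed.

Lemma kolmogorov_space_inj (X Y : topologicalType) (f : Y -> X) :
  continuous f -> injective f -> kolmogorov_space X -> kolmogorov_space Y.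
Proof.
move=> cf finj T0X x y xy.
have fxy : f x != f y by apply: contra_neq xy => /finj.
have [A [[]|[]]] := T0X _ _ fxy; rewrite !inE => fA nA; exists (f @^-1` A).
- by left; rewrite !inE; split=> //; exact: cf.
- by right; rewrite !inE; split=> //; exact: cf.
Qed.

(** The retraction [r] supplies preimages in [D] for a finite part of the image; [s] then lifts
    their upper bound by monotonicity. *)
Lemma directed_section (X Y : topologicalType) (s : Y -> X) (r : X -> Y)
    (D : set Y) :
  continuous s -> cancel s r -> directed D -> directed (s @` D).
Proof.
move=> cs sK [[d0 Dd0] dirD]; split; first by exists (s d0), d0.
move=> F finF FD.
have rFD : r @` F `<=` D by move=> _ [x /FD [d Dd <-] <-]; rewrite sK.
have [u Du ub] := dirD _ (finite_image r finF) rFD.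
exists (s u); first by exists u.
move=> x Fx; have [d Dd sdx] := FD _ Fx.
rewrite -sdx; apply: spec_le_continuous => //.
by apply: ub; exists x => //; rewrite -sdx sK.
Qed.

Theorem theorem3p15 (X Y : topologicalType) (hX : dstar_space X)
  (hYX : is_retract Y X) : dstar_space Y.
Proof.
have [T0X dX] := hX; have [s [r [cs cr rs]]] := hYX.
have sK : cancel s r by move=> y; exact: (congr1 (@^~ y) rs).
split; first exact: kolmogorov_space_inj cs (can_inj sK) T0X.
move=> D y U dirD oU [u Uu] DyU.
have oV : open (r @^-1` U) by apply: open_comp => // x _; exact: cr.
have V0 : r @^-1` U !=set0 by exists (s u); rewrite /= sK.
have [|_ [d Dd <-] dyV] := dX _ (s y) _ (directed_section _ _ _ _ _ cs sK dirD) oV V0.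
  (* Monotonicity of [r] sends a point [x] above all [s d] and above [s y] to [r x], above [D] and
     [y], hence in [U]. *)
  move=> x [Dx yx]; apply: DyU; split=> [d Dd|]; rewrite /upset /=.
  - by rewrite -(sK d); apply: spec_le_continuous => //; apply: Dx; exists d.
  - by rewrite -(sK y); exact: spec_le_continuous.
exists d => // z [dz yz]; rewrite -(sK z).
(* Now [s] is the monotone map used: [s z] lies above [s d] and [s y]. *)
by apply: dyV; split; exact: spec_le_continuous.
Qed.
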